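(* Let $k$ be an algebraically closed field of characteristic $p>0$, let $G$ be a finite group which is abelian or $p$-elementary, and let $r$ be the smallest prime divisor of $|G|$. Then there exists a polynomial ring $\mathcal F$ over $k$ of Krull dimension $\le \log_r(|G|)$ such that $G$ acts faithfully on $\mathcal F$ by $k$-algebra automorphisms with $\mathcal F^G\cong \mathcal F$ as $k$-algebras.
   Context: A finite group is called $p$-elementary if it is a direct product of a cyclic group of order coprime to $p$ and a $p$-group. $\mathcal F^G$ denotes the ring of $G$-invariants. The action is not required to be linear. *)

(* Defs.v *)
From HB Require Import structures.
From mathcomp Require Import all_boot all_order all_fingroup all_algebra all_solvable.
From mathcomp Require Export ring_quotient.
From mathcomp Require Export mpoly.

Set Implicit Arguments.
Unset Strict Implicit.
Unset Printing Implicit Defensive.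

Import GRing.Theory.
Local Open Scope ring_scope.

Definition p_elementary (p : nat) (gT : finGroupType) (G : {group gT}) : Prop :=
  exists C P : {group gT},
    [/\ (C \x P = G)%g, cyclic C, coprime #|C| p & (p.-group P)%g].

(* [prime_idealr R] is MathComp's type of proper prime ideals, given as boolean
   predicates; classically every prime ideal is of this form. *)
Definition prime_chain (R : comNzRingType) (m : nat)
    (I : 'I_m.+1 -> prime_idealr R) : Prop :=
  forall i j : 'I_m.+1, (i < j)%N ->
    {subset I i <= I j} /\ exists2 x : R, x \in I j & x \notin I i.

Definition krull_dim (R : comNzRingType) (d : nat) : Prop :=
  (exists I : 'I_d.+1 -> prime_idealr R, prime_chain I) /\
  (forall (m : nat) (I : 'I_m.+1 -> prime_idealr R),
     prime_chain I -> (m <= d)%N).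

(* An action of G by k-algebra automorphisms: bijectivity of each map is
   automatic for a group action. MathComp actions are right actions; composing
   with inversion in G exchanges them with left actions. *)
Record algebra_action (k : fieldType) (gT : finGroupType) (G : {group gT})
    (A : comAlgType k) : Type := AlgebraAction {
  alg_act :> action G A;
  alg_act_linear : forall g, g \in G -> linear (alg_act^~ g);
  alg_act_monoid : forall g, g \in G -> monoid_morphism (alg_act^~ g)
}.

(* MathComp's [faithful] requires the set acted upon to be finite. *)
Definition faithful_action (k : fieldType) (gT : finGroupType)
    (G : {group gT}) (A : comAlgType k) (to : algebra_action G A) : Prop :=
  forall g, g \in G -> (forall f : A, to f g = f) -> g = 1%g.

Definition invariant_pred (k : fieldType) (gT : finGroupType)
    (G : {group gT}) (A : comAlgType k) (to : algebra_action G A) : {pred A} :=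
  fun f => [forall g in G, to f g == f].

Section Invariants.
Variables (k : fieldType) (gT : finGroupType) (G : {group gT}).
Variables (A : comAlgType k) (to : algebra_action G A).

Lemma invariantP (f : A) :
  reflect (forall g, g \in G -> to f g = f) (f \in invariant_pred to).
Proof.
apply: (iffP forallP) => [h g gG | h g].
  by move/implyP: (h g) => /(_ gG) /eqP.
by apply/implyP => /h ->.
Qed.

Lemma invariant_subalg : subalg_closed (invariant_pred to).
Proof.
split.
- by apply/invariantP => g gG; case: (alg_act_monoid to gG).
- move=> a u v /invariantP hu /invariantP hv; apply/invariantP => g gG.
  by rewrite (alg_act_linear to gG) hu ?hv.
- move=> u v /invariantP hu /invariantP hv; apply/invariantP => g gG.
  by case: (alg_act_monoid to gG) => _ ->; rewrite hu ?hv.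
Qed.

HB.instance Definition _ :=
  GRing.isSubalgClosed.Build k A (invariant_pred to) invariant_subalg.

Definition invariants : Type := {f : A | f \in invariant_pred to}.

HB.instance Definition _ := SubChoice.on invariants.
HB.instance Definition _ := [SubChoice_isSubAlgebra of invariants by <:].

End Invariants.

Definition algebra_isomorphic (k : fieldType) (A B : algType k) : Prop :=
  exists phi : {lrmorphism A -> B}, bijective phi.

(* Main.v *)
(** A realization of a quotient of G on a polynomial ring B is extended to G by
adjoining one variable X on which G acts through X |-> u(g) X + c(g). If some
monic Y in B[X] is invariant and every invariant of degree < deg Y is constant
in X, then division by Y gives B[X]^G = B^Q[Y].

For a p-group P take z central of order p and Q = P / <z>. Suppose the action of
Q on B has an element b of trace 1. Averaging against b kills the cohomology of
Q in B, so the character z |-> 1 extends to a 1-cocycle c : P -> B, and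
c^p - c is the coboundary of some e; then X |-> X + c(g) and Y = X^p - X + e
work, and - b X^(p-1) again has trace 1. Each step costs a factor p of |P|. For
a further direct factor <x> of order m prime to p use X |-> zeta X and Y = X^m.

For the Krull dimension, let a_i lie in the i-th but not the (i-1)-st prime of a
chain. Comparing terms of least degree in one variable at a time, a nonzero
polynomial in the a_i is never in the bottom prime, whereas n + 1 elements of
k[x_1, ..., x_n] are algebraically dependent. *)

Require Import Defs.
From HB Require Import structures.
From mathcomp Require Import all_boot all_order all_fingroup all_algebra all_solvable.
From mathcomp Require Import ring separable cyclotomic.
Set Implicit Arguments.
Unset Strict Implicit.
Unset Printing Implicit Defensive.
Import GRing.Theory.
Local Open Scope ring_scope.

(** * Polynomials in [n + 1] variables as univariate polynomials in the last one *)

Lemma mpoly_rmorphism_ext (n : nat) (R S : comNzRingType)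
    (f g : {rmorphism {mpoly R[n]} -> S}) :
  (forall c, f c%:MP = g c%:MP) -> (forall i, f 'X_i = g 'X_i) -> f =1 g.
Proof.
move=> fgC fgX q; rewrite [q]mpolyE !rmorph_sum /=; apply: eq_bigr => m _.
rewrite -mul_mpolyC !rmorphM fgC; congr (_ * _).
rewrite mpolyXE_id !rmorph_prod; apply: eq_bigr => i _.
by rewrite !rmorphXn fgX.
Qed.

Lemma poly_rmorphism_ext (R S : nzRingType) (f g : {rmorphism {poly R} -> S}) :
  (forall c, f c%:P = g c%:P) -> f 'X = g 'X -> f =1 g.
Proof.
move=> fgC fgX q; rewrite -[q]coefK poly_def !rmorph_sum /=.
by apply: eq_bigr => i _; rewrite -mul_polyC !rmorphM !rmorphXn fgC fgX.
Qed.

Local Notation widen := (widen_ord (leqnSn _)).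

Section Muni.
Variables (n : nat) (R : comNzRingType).

Lemma ord_widenP (P : 'I_n.+1 -> Prop) :
  (forall i : 'I_n, P (widen i)) -> P ord_max -> forall i, P i.
Proof.
move=> Pw Pm i; case: (unliftP ord_max i) => [j ->|-> //].
suff -> : lift ord_max j = widen j by [].
by apply: val_inj; rewrite /= /bump leqNgt ltn_ord.
Qed.

Lemma mwidenX1 (i : 'I_n) : mwiden ('X_i : {mpoly R[n]}) = 'X_(widen i).
Proof. by rewrite mwidenX mnmwiden1. Qed.

Lemma muniX_widen (i : 'I_n) : muni ('X_(widen i) : {mpoly R[n.+1]}) = ('X_i)%:P.
Proof.
rewrite muniE msuppX big_seq1 mcoeffX eqxx scale1r.
rewrite mnm1E (_ : _ == _ = false) ?expr0 ?alg_polyC; last first.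
  by rewrite -val_eqE /= ltn_eqF.
congr ('X_[_])%:P; apply/mnmP => j; rewrite !mnmE.
by rewrite -!val_eqE.
Qed.

Lemma muniX_max : muni ('X_ord_max : {mpoly R[n.+1]}) = 'X.
Proof.
rewrite muniE msuppX big_seq1 mcoeffX eqxx scale1r mnm1E eqxx expr1.
rewrite (_ : [multinom _ | _ < _] = 0%MM) ?mpolyX0 ?scale1r //.
by apply/mnmP => j; rewrite !mnmE -val_eqE /= gtn_eqF.
Qed.

Definition muni_inv : {rmorphism {poly {mpoly R[n]}} -> {mpoly R[n.+1]}} :=
  horner_morph (fun x : {mpoly R[n]} => mulrC 'X_ord_max (mwiden x)).

Lemma muniK : cancel (@muni n R) muni_inv.
Proof.
apply: (@mpoly_rmorphism_ext _ _ _ (muni_inv \o @muni n R)%FUN idfun).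
  by move=> c; rewrite /= muniC horner_morphC; exact: mwidenC.
apply: ord_widenP => [i|] /=.
  by rewrite muniX_widen horner_morphC; exact: mwidenX1.
by rewrite muniX_max horner_morphX.
Qed.

Lemma muni_invK : cancel muni_inv (@muni n R).
Proof.
apply: (@poly_rmorphism_ext _ _ (@muni n R \o muni_inv)%FUN idfun).
  move=> c; rewrite /= horner_morphC; move: c.
  apply: (@mpoly_rmorphism_ext _ _ _ (@muni n R \o @mwiden n R)%FUN polyC).
    by move=> c; rewrite /= mwidenC muniC.
  by move=> i /=; rewrite mwidenX1 muniX_widen.
by rewrite /= horner_morphX muniX_max.
Qed.

Lemma muni_bij : bijective (@muni n R).
Proof. exact: Bijective muniK muni_invK. Qed.

End Muni.

(** * Adjoining a variable to a realization *)

Section Substitution.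
Variables (A B : idomainType) (f : {rmorphism A -> B}) (w : {poly B}).

Definition poly_subst : {rmorphism {poly A} -> {poly B}} :=
  horner_morph (fun a : A => mulrC w ((polyC \o f)%FUN a)).

Lemma poly_substC a : poly_subst a%:P = (f a)%:P.
Proof. exact: horner_morphC. Qed.

Lemma poly_substX : poly_subst 'X = w.
Proof. exact: horner_morphX. Qed.

Lemma poly_substE q : poly_subst q = map_poly f q \Po w.
Proof.
apply: (@poly_rmorphism_ext _ _ poly_subst (comp_poly w \o map_poly f)%FUN).
  by move=> c; rewrite /= poly_substC map_polyC comp_polyC.
by rewrite /= poly_substX map_polyX comp_polyX.
Qed.

(** Substituting a [w] of degree at most 1 cannot raise the degree, so the action keeps remainders
    modulo [Y] small. *)
Lemma size_poly_subst q : (size w <= 2)%N -> (size (poly_subst q) <= size q)%N.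
Proof.
move=> w2; rewrite poly_substE; have [->|q0] := eqVneq q 0.
  by rewrite rmorph0 comp_poly0 size_poly0.
have q_gt0 : (0 < size q)%N by rewrite size_poly_gt0.
rewrite -(prednK q_gt0); apply: leq_trans (size_comp_poly_leq _ _) _.
rewrite ltnS -[leqRHS]muln1; apply: leq_mul.
  by rewrite -!subn1; apply: leq_sub2r; exact: size_poly.
by rewrite -subn1 leq_subLR.
Qed.

Lemma poly_subst_inj : injective f -> (1 < size w)%N -> injective poly_subst.
Proof.
move=> f_inj w1; apply: raddf_inj => q.
rewrite [X in X = _ -> _](_ : _ = poly_subst q) // poly_substE => q0.
have fq0 : map_poly f q = 0.
  have := size_comp_poly (map_poly f q) w; rewrite q0 size_poly0 /=.
  move/esym/eqP; rewrite muln_eq0 -(subn1 (size w)) subn_eq0 leqNgt w1 orbF => /eqP h.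
  have : (size (map_poly f q) <= 1)%N by case: size h => // -[].
  by move/size1_polyC => h1; move: q0; rewrite h1 comp_polyC.
by apply: (map_inj_poly f_inj (rmorph0 f)); rewrite fq0 rmorph0.
Qed.

End Substitution.

(* A right action of [G] on [B = rz_ring], a polynomial ring over [k] in [n]
   variables through [rz_coord], whose ring of invariants is again polynomial in
   [n] variables through [rz_inv]. The ring [B] is kept abstract so that a
   variable can be adjoined by passing to [{poly B}]. *)
Record realization (k : fieldType) (gT : finGroupType) (G : {group gT})
    (n : nat) : Type := Realization {
  rz_ring : idomainType;
  rz_coord : {rmorphism {mpoly k[n]} -> rz_ring};
  rz_inv : {rmorphism {mpoly k[n]} -> rz_ring};
  rz_act : gT -> {rmorphism rz_ring -> rz_ring};
  rz_coord_bij : bijective rz_coord;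
  rz_inv_inj : injective rz_inv;
  rz_invC : forall c, rz_inv c%:MP = rz_coord c%:MP;
  rz_actC : forall g c, g \in G -> rz_act g (rz_coord c%:MP) = rz_coord c%:MP;
  rz_act1 : forall b, rz_act 1%g b = b;
  rz_actM : forall g h b, g \in G -> h \in G ->
    rz_act (g * h)%g b = rz_act h (rz_act g b);
  rz_faithful : forall g, g \in G -> (forall b, rz_act g b = b) -> g = 1%g;
  rz_invP : forall b,
    (forall g, g \in G -> rz_act g b = b) <-> exists F, b = rz_inv F
}.

Section Extension.
Variables (k : fieldType) (gT qT : finGroupType) (G : {group gT}).
Variables (Q : {group qT}) (n : nat) (R : realization k Q n).
Local Notation B := (rz_ring R).
Variables (pi : gT -> qT) (w : gT -> {poly B}) (Y : {poly B}).
Hypothesis piG : forall g, g \in G -> pi g \in Q.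
Hypothesis pi_surj : forall q, q \in Q -> exists2 g, g \in G & pi g = q.
Hypothesis pi1 : pi 1%g = 1%g.
Hypothesis piM : forall g h, g \in G -> h \in G -> pi (g * h)%g = (pi g * pi h)%g.

(** A ring morphism for every choice of [w]; the group law is the cocycle condition [wM] below, in
    its form for right actions. *)
Definition ext_act (g : gT) : {rmorphism {poly B} -> {poly B}} :=
  poly_subst (rz_act R (pi g)) (w g).

Hypothesis w1 : w 1%g = 'X.
Hypothesis wM : forall g h, g \in G -> h \in G -> w (g * h)%g = ext_act h (w g).
Hypothesis w_size : forall g, g \in G -> (size (w g) <= 2)%N.
Hypothesis w_faithful : forall g, g \in G -> pi g = 1%g -> w g = 'X -> g = 1%g.
Hypothesis Y_monic : Y \is monic.
Hypothesis Y_size : (1 < size Y)%N.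
Hypothesis Y_inv : forall g, g \in G -> ext_act g Y = Y.
Hypothesis inv_const : forall r : {poly B}, (size r < size Y)%N ->
  (forall g, g \in G -> ext_act g r = r) -> (size r <= 1)%N.

Let coord : {rmorphism {mpoly k[n.+1]} -> {poly B}} :=
  poly_subst (rz_coord R) 'X \o @muni n k.
Let inv : {rmorphism {mpoly k[n.+1]} -> {poly B}} :=
  poly_subst (rz_inv R) Y \o @muni n k.

Let coord_bij : bijective coord.
Proof.
have muni_bij := muni_bij n k.
apply: bij_comp; last exact: muni_bij.
have [c' cK c'K] := rz_coord_bij R.
have c'0 : c' 0 = 0 by rewrite -(rmorph0 (rz_coord R)) cK.
exists (map_poly c') => q; rewrite poly_substE comp_polyXr; apply/polyP => i.
  by rewrite coef_map_id0 // coef_map /= cK.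
by rewrite coef_map /= coef_map_id0 // c'K.
Qed.

Let inv_inj : injective inv.
Proof.
apply: inj_comp; last exact: bij_inj (muni_bij n k).
exact: poly_subst_inj (@rz_inv_inj _ _ _ _ R) Y_size.
Qed.

Let invC c : inv c%:MP = coord c%:MP.
Proof. by rewrite /inv /coord /= muniC !poly_substC rz_invC. Qed.

Let actC g c : g \in G -> ext_act g (coord c%:MP) = coord c%:MP.
Proof. by move=> gG; rewrite /coord /= muniC !poly_substC rz_actC // piG. Qed.

Let act1 f : ext_act 1%g f = f.
Proof.
move: f; apply: (@poly_rmorphism_ext _ _ (ext_act 1%g) idfun) => [c|].
  by rewrite poly_substC pi1 rz_act1.
by rewrite poly_substX w1.
Qed.

Let actM g h f : g \in G -> h \in G ->
  ext_act (g * h)%g f = ext_act h (ext_act g f).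
Proof.
move=> gG hG; move: f.
apply: (@poly_rmorphism_ext _ _ (ext_act (g * h)%g) (ext_act h \o ext_act g)%FUN).
  by move=> c; rewrite /= !poly_substC piM // rz_actM ?piG.
by rewrite /= !poly_substX wM.
Qed.

Let act_faithful g : g \in G -> (forall f, ext_act g f = f) -> g = 1%g.
Proof.
move=> gG gid; apply: w_faithful => //; last by rewrite -(gid 'X) poly_substX.
apply: (@rz_faithful _ _ _ _ R); first exact: piG.
by move=> b; apply: (@polyC_inj B); rewrite -(poly_substC _ (w g)); exact: gid.
Qed.

(** Induction on the degree of [f]: quotient and remainder of an invariant by [Y] are invariant, the
    remainder is a constant fixed by [Q], and the quotient has smaller degree. *)
Let act_invP f :
  (forall g, g \in G -> ext_act g f = f) <-> exists F, f = inv F.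
Proof.
split=> [|[F ->] g gG]; last first.
  have [q ->] : exists q, inv F = poly_subst (rz_inv R) Y q by exists (muni F).
  move: q; apply: (@poly_rmorphism_ext _ _ (ext_act g \o poly_subst (rz_inv R) Y)%FUN).
    move=> c; rewrite /= !poly_substC; congr _%:P.
    by have [_ ->] := rz_invP (rz_inv R c); [|exists c|exact: piG].
  by rewrite /= poly_substX Y_inv.
suff H m : forall f : {poly B}, (size f <= m)%N ->
    (forall g, g \in G -> ext_act g f = f) -> exists q, f = poly_subst (rz_inv R) Y q.
  move=> finv; have [q ->] := H _ f (leqnn _) finv.
  by exists (muni_inv n k q); rewrite /inv /= muni_invK.
elim: m => [|m IH] {}f fm finv.
  by exists 0; rewrite rmorph0; apply/eqP; rewrite -size_poly_eq0 -leqn0.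
have Y0 : Y != 0 by rewrite monic_neq0.
pose d := Pdiv.CommonRing.rdivp f Y; pose r := Pdiv.CommonRing.rmodp f Y.
have fE : f = d * Y + r by exact: Pdiv.RingMonic.rdivp_eq.
have rY : (size r < size Y)%N by rewrite Pdiv.CommonRing.ltn_rmodpN0.
(* Applying [g] to [f = d * Y + r] gives another division by [Y]; uniqueness for the monic [Y]
   identifies the two. *)
have dr_inv g : g \in G -> ext_act g d = d /\ ext_act g r = r.
  move=> gG; have := finv g gG; rewrite {1}fE rmorphD rmorphM /= Y_inv // => fE'.
  have r'Y : (size (ext_act g r) < size Y)%N.
    by apply: leq_ltn_trans rY; apply: size_poly_subst; exact: w_size.
  split; apply/esym.
    by rewrite {1}/d -{1}fE' Pdiv.RingMonic.rdivp_addl_mul_small.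
  by rewrite {1}/r -{1}fE' Pdiv.RingMonic.rmodp_addl_mul_small.
have d_size : (size d <= m)%N.
  have [->|d0] := eqVneq d 0; first by rewrite size_poly0.
  rewrite -ltnS; apply: leq_trans fm; rewrite fE size_polyDl.
    rewrite size_Mmonic // -subn1 -addnBA; last exact: ltnW.
    by rewrite -[X in (X <= _)%N]addn1 leq_add2l subn_gt0.
  rewrite size_Mmonic //; apply: (leq_trans rY).
  by case: (size d) (size_poly_gt0 d) => [|s]; rewrite ?d0 // addSn leq_addl.
have [q dE] := IH d d_size (fun g gG => (dr_inv g gG).1).
have r1 : (size r <= 1)%N := inv_const rY (fun g gG => (dr_inv g gG).2).
have [F rF] : exists F, r`_0 = rz_inv R F.
  apply/rz_invP => h /pi_surj [g gG <-].
  have := (dr_inv g gG).2; rewrite [r]size1_polyC // poly_substC.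
  by move/polyC_inj; rewrite coefC.
exists (q * 'X + F%:P).
by rewrite fE dE rmorphD rmorphM /= poly_substX poly_substC [r]size1_polyC // rF.
Qed.

Definition ext_realization : realization k G n.+1 :=
  Realization coord_bij inv_inj invC actC act1 actM act_faithful act_invP.

End Extension.

(** * Central extensions by a group of order p *)

Section CyclicExponent.
Variables (gT : finGroupType) (z : gT).

(** The discrete logarithm to base [z], below the order of [z]; off [<[z]>] it takes the default
    value 0. *)
Definition cyc_exp (y : gT) : nat :=
  if [pick i : 'I_#[z]%g | y == (z ^+ i)%g] is Some i then i else 0%N.

Lemma expg_cyc_exp y : y \in <[z]>%g -> (z ^+ cyc_exp y)%g = y.
Proof.
move=> /cyclePmin [i lti ->]; rewrite /cyc_exp.
case: pickP => [j /eqP -> //|/(_ (Ordinal lti))]; by rewrite eqxx.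
Qed.

Lemma cyc_expM y y' : y \in <[z]>%g -> y' \in <[z]>%g ->
  cyc_exp (y * y')%g = cyc_exp y + cyc_exp y' %[mod #[z]%g].
Proof.
move=> yz y'z; apply/eqP; rewrite -eq_expg_mod_order expgD.
by rewrite !expg_cyc_exp ?groupM.
Qed.

Lemma cyc_expX i : cyc_exp (z ^+ i)%g = i %[mod #[z]%g].
Proof.
by apply/eqP; rewrite -eq_expg_mod_order expg_cyc_exp ?mem_cycle.
Qed.

End CyclicExponent.

Lemma pchar_natr_mod (R : nzRingType) (p a b : nat) : p \in [pchar R] ->
  a = b %[mod p] -> a%:R = b%:R :> R.
Proof.
move=> pR ab; rewrite (divn_eq a p) (divn_eq b p) ab.
by rewrite !natrD !natrM !(pcharf0 pR) !mulr0.
Qed.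

(** The values of [r] at 0, ..., p - 1 agree, and these are p distinct elements of [B]; hence
    [r - r(0)], of degree less than p, has p roots and vanishes. *)
Lemma shift_invariant_const (B : idomainType) (p : nat) (r : {poly B}) :
  p \in [pchar B] -> (size r <= p)%N -> r \Po ('X + 1) = r -> (size r <= 1)%N.
Proof.
move=> pB rp rinv; pose s := r - (r.[0])%:P.
have r_nat i : r.[i%:R] = r.[0].
  elim: i => // i IH; rewrite -{1}IH -{2}rinv horner_comp hornerD hornerX.
  by rewrite hornerC mulrSr.
have s0 : s = 0.
  apply/eqP; apply: contraT => sN0.
  have s_size : (size s <= p)%N.
    apply: leq_trans (size_polyD _ _) _; rewrite geq_max rp size_polyN.
    by apply: leq_trans (size_polyC_leq1 _) _; rewrite prime_gt0 // (pcharf_prime pB).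
  have := max_poly_roots (rs := [seq i%:R | i <- iota 0 p]) sN0.
  rewrite size_map size_iota => H; have : (p < size s)%N.
    apply: H.
      by apply/allP => _ /mapP [i _ ->]; rewrite /root !hornerE r_nat subrr.
    rewrite map_inj_in_uniq ?iota_uniq // => i j.
    rewrite !mem_iota !add0n /= => ip jp /eqP ij.
    wlog : i j ip jp ij / (i <= j)%N => [W|ij'].
      by case: (leqP i j) => [/W|/ltnW /W H']; [apply|rewrite H' // eq_sym].
    apply/eqP; rewrite eqn_leq ij' /=.
    move: ij; rewrite eq_sym -subr_eq0 -natrB // -(dvdn_pcharf pB).
    case: (posnP (j - i)) => [/eqP|d0 /(dvdn_leq d0)]; first by rewrite subn_eq0.
    by rewrite leqNgt (leq_ltn_trans (leq_subr i j) jp).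
  by rewrite ltnNge s_size.
by move/eqP: s0; rewrite subr_eq0 => /eqP ->; exact: size_polyC_leq1.
Qed.

Section CentralExtension.
Variables (k : fieldType) (p : nat) (gT : finGroupType) (P : {group gT}) (z : gT).
Local Notation Z := <[z]>%G.
Hypothesis pk : p \in [pchar k].
Hypothesis zZ : z \in 'Z(P)%g.
Hypothesis z_order : #[z]%g = p.
Variables (n : nat) (R : realization k (P / Z)%G n).
Local Notation B := (rz_ring R).
Variable b0 : B.
Hypothesis trace_b0 : \sum_(q in (P / Z)%g) rz_act R q b0 = 1.

Let zP : z \in P. Proof. by case/setIP: zZ. Qed.

Let sZP : (Z \subset P)%g. Proof. by rewrite cycle_subG. Qed.

Let central x y : x \in P -> y \in Z -> (x * y = y * x)%g.
Proof.
move=> xP yZ; apply: esym; apply: (centP _ _ xP).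
by apply: (subsetP _ _ yZ); rewrite cycle_subG; case/setIP: zZ.
Qed.

Let nZP : (Z <| P)%g.
Proof.
rewrite /normal sZP /=; apply: (subset_trans _ (cent_sub _)).
by rewrite centsC cycle_subG; case/setIP: zZ.
Qed.

Let nZ x : x \in P -> x \in 'N(Z)%g.
Proof. by move/(subsetP (normal_norm nZP)). Qed.

Let pB : p \in [pchar B].
Proof.
rewrite inE (pcharf_prime pk) -(rmorph_nat (rz_coord R)).
by rewrite -(rmorph_nat (@mpolyC n k)) (pcharf0 pk) !rmorph0 /=.
Qed.

Let coset_mem_quo x : x \in P -> coset Z x \in (P / Z)%g.
Proof. exact: mem_quotient. Qed.

Let reprP q : q \in (P / Z)%g -> repr q \in P.
Proof.
move=> qQ; rewrite -(quotientGK nZP) mem_morphpre ?repr_coset_norm //=.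
by rewrite coset_reprK.
Qed.

(** The isomorphism of [Z] onto the prime field of [B] that sends [z] to 1. *)
Let chi (y : gT) : B := (cyc_exp z y)%:R.

Let chiM y y' : y \in Z -> y' \in Z -> chi (y * y')%g = chi y + chi y'.
Proof.
move=> yZ y'Z; rewrite /chi -natrD; apply: (pchar_natr_mod pB).
by rewrite -z_order cyc_expM.
Qed.

Let chi_z : chi z = 1.
Proof.
by apply: (pchar_natr_mod (b := 1%N) pB); rewrite -z_order -(cyc_expX z 1) expg1.
Qed.

Let chi_eq0 y : y \in Z -> chi y = 0 -> y = 1%g.
Proof.
move=> yZ /eqP; rewrite -(dvdn_pcharf pB) -z_order order_dvdn.
by rewrite expg_cyc_exp // => /eqP.
Qed.

(* A function [P -> F_p] equivariant under [Z]; the formal average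
   [\sum_q lam (repr q) * q b0] is not well defined, but its differences under
   [P], which give [cocycle] below, are. *)
Let lam (x : gT) : B := chi ((repr (coset Z x))^-1 * x)%g.

Let repr_coset_mem x : x \in P -> ((repr (coset Z x))^-1 * x)%g \in Z.
Proof.
move=> xP; have xQ := coset_mem_quo xP.
apply: coset_idr; first by rewrite groupM ?groupV ?nZ // reprP.
by rewrite morphM ?morphV ?groupV ?nZ ?reprP //= coset_reprK mulVg.
Qed.

Let lamM x y : x \in P -> y \in Z -> lam (x * y)%g = lam x + chi y.
Proof.
move=> xP yZ; have yP := subsetP sZP _ yZ.
have cE : coset Z (x * y)%g = coset Z x.
  by rewrite morphM ?nZ //= (coset_id yZ) mulg1.
by rewrite /lam cE mulgA chiM // repr_coset_mem.
Qed.

Let D (q : coset_of Z) (g : gT) : B := lam (repr q) - lam (repr q * g^-1)%g.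

(** [x] differs from its coset representative by a central [y], which adds [chi y] to both terms of
    the difference. *)
Let D_coset x g : x \in P -> g \in P ->
  D (coset Z x) g = lam x - lam (x * g^-1)%g.
Proof.
move=> xP gP; rewrite /D; set r := repr _.
have yZ := repr_coset_mem xP; rewrite -/r in yZ.
have rP : r \in P by apply: reprP; exact: coset_mem_quo.
set y := (r^-1 * x)%g in yZ; have -> : x = (r * y)%g by rewrite /y mulKVg.
rewrite (lamM rP yZ) -mulgA -(central _ yZ) ?groupV // mulgA.
by rewrite (lamM _ yZ) ?groupM ?groupV // opprD addrACA subrr addr0.
Qed.

Let D_fixed h q g : rz_act R h (D q g) = D q g.
Proof. by rewrite rmorphB !rmorph_nat. Qed.

(** Formally this is [S - g S] for the average [S] of [lam] against [b0], which is why the cocycle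
    identity holds. *)
Definition cocycle (g : gT) : B := \sum_(q in (P / Z)%g) D q g * rz_act R q b0.
Local Notation c := cocycle.

Let reindexQ h (F : coset_of Z -> B) : h \in (P / Z)%g ->
  \sum_(q in (P / Z)%g) F q = \sum_(q in (P / Z)%g) F (q * h)%g.
Proof.
move=> hQ; rewrite (reindex_inj (mulIg h)) /=.
by apply: eq_bigl => q; rewrite groupMr.
Qed.

Let cM g h : g \in P -> h \in P -> c (g * h)%g = c h + rz_act R (coset Z h) (c g).
Proof.
move=> gP hP; have hQ := coset_mem_quo hP; have hQV := groupVr hQ.
(* Shifting the second sum by the inverse of [h] aligns the factors [rz_act R q b0]; the differences
   of [lam] then telescope. *)
rewrite /c rmorph_sum /= [X in _ + X](reindexQ _ hQV) -big_split /=.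
apply: eq_bigr => q qQ; rewrite rmorphM D_fixed -rz_actM ?groupM //.
rewrite mulgKV -mulrDl; congr (_ * _).
have rP := reprP qQ.
have -> : (q * (coset Z h)^-1)%g = coset Z (repr q * h^-1)%g.
  by rewrite morphM ?morphV ?groupV ?nZ //= coset_reprK.
rewrite D_coset ?groupM ?groupV // /D invMg mulgA addrA; congr (_ - _).
by rewrite subrK.
Qed.

(** Translation by [y] in [Z] changes [lam] by [chi y] on every coset, and the weights
    [rz_act R q b0] sum to 1. *)
Let c_chi y : y \in Z -> c y = chi y.
Proof.
move=> yZ; rewrite -[RHS]mulr1 -trace_b0 mulr_sumr; apply: eq_bigr => q qQ.
congr (_ * _); have rP := reprP qQ; have yP := subsetP sZP _ yZ.
rewrite /D -{1}(mulgKV y (repr q)) lamM ?groupM ?groupV //.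
by rewrite addrAC subrr add0r.
Qed.

Let c1 : c 1%g = 0.
Proof.
rewrite c_chi ?group1 // /chi; apply/eqP.
by rewrite -(dvdn_pcharf pB) -z_order order_dvdn expg_cyc_exp.
Qed.

(** The Artin-Schreier operator applied to [c]. It is additive and commutes with the action, so [d]
    is a cocycle too; it kills the prime field, so [d] vanishes on [Z] and descends to [P / Z]. *)
Let d (g : gT) : B := c g ^+ p - c g.

Let dM g h : g \in P -> h \in P -> d (g * h)%g = d h + rz_act R (coset Z h) (d g).
Proof.
move=> gP hP; rewrite /d cM // rmorphB rmorphXn -!(pFrobenius_autE pB).
by rewrite rmorphD /= opprD addrACA.
Qed.

Let d_Z y : y \in Z -> d y = 0.
Proof.
move=> yZ; rewrite /d c_chi // /chi -(pFrobenius_autE pB).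
by rewrite pFrobenius_aut_nat subrr.
Qed.

Let d_coset x : x \in P -> d (repr (coset Z x)) = d x.
Proof.
move=> xP; have yZ := repr_coset_mem xP; set r := repr _ in yZ *.
have rP : r \in P by apply: reprP; exact: coset_mem_quo.
rewrite -[in RHS](mulKVg r x) dM ?groupM ?groupV // (d_Z yZ) add0r.
by rewrite coset_id // rz_act1.
Qed.

(* Averaging against [b0] shows that the cocycle [d] of [P / Z] is a coboundary. *)
Let e : B := \sum_(q in (P / Z)%g) d (repr q) * rz_act R q b0.

(** The defect [- d g] is what [Y] requires: [X |-> X + c g] adds [c g ^+ p - c g = d g] to
    [X^p - X]. *)
Let eP g : g \in P -> rz_act R (coset Z g) e = e - d g.
Proof.
move=> gP; have gQ := coset_mem_quo gP.
rewrite -[d g]mulr1 -trace_b0 mulr_sumr -sumrB /e.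
rewrite [RHS](reindexQ _ gQ) rmorph_sum /=; apply: eq_bigr => q qQ.
rewrite -mulrBl rmorphM rz_actM //; congr (_ * _).
have rP := reprP qQ.
change (rz_act R (coset Z g) (d (repr q)) = d (repr (q * coset Z g)%g) - d g).
have -> : (q * coset Z g)%g = coset Z (repr q * g)%g.
  by rewrite morphM ?nZ //= coset_reprK.
by rewrite d_coset ?groupM // dM // addrAC subrr add0r.
Qed.

Let w (g : gT) : {poly B} := 'X + (c g)%:P.
Let Y : {poly B} := 'X^p - 'X + e%:P.
Local Notation act := (ext_act (coset Z) w).

Let p_gt1 : (1 < p)%N. Proof. exact: prime_gt1 (pcharf_prime pk). Qed.

Let Y_tail : (size (- 'X + e%:P : {poly B})%R < p.+1)%N.
Proof.
rewrite ltnS; apply: leq_trans (size_polyD _ _) _.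
rewrite size_polyN size_polyX geq_max p_gt1.
by apply: leq_trans (size_polyC_leq1 _) _; apply: ltnW.
Qed.

Let Y_size : size Y = p.+1.
Proof. by rewrite /Y -addrA size_polyDl size_polyXn. Qed.

Let w_size g : (size (w g) <= 2)%N.
Proof. by rewrite size_XaddC. Qed.

Let pBx : p \in [pchar {poly B}]. Proof. by rewrite pchar_poly. Qed.

Let Y_inv g : g \in P -> act g Y = Y.
Proof.
move=> gP; rewrite /Y rmorphD rmorphB rmorphXn /= !poly_substX poly_substC eP //.
rewrite -(pFrobenius_autE pBx) rmorphD /= !pFrobenius_autE -polyC_exp /d.
rewrite !polyCB opprD !addrA; ring.
Qed.

Let w1 : w 1%g = 'X. Proof. by rewrite /w c1 addr0. Qed.

Let wM g h : g \in P -> h \in P -> w (g * h)%g = act h (w g).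
Proof.
move=> gP hP; rewrite /w rmorphD /= poly_substX poly_substC cM // polyCD.
by rewrite addrA.
Qed.

Let w_faithful g : g \in P -> coset Z g = 1%g -> w g = 'X -> g = 1%g.
Proof.
move=> gP /(coset_idr (nZ gP)) gZ /(congr1 (fun q : {poly B} => q`_0)).
by rewrite coefD coefX coefC add0r /= c_chi // => /(chi_eq0 gZ).
Qed.

Let act_z (r : {poly B}) : act z r = r \Po ('X + 1).
Proof.
rewrite poly_substE /w c_chi ?cycle_id // chi_z; congr (_ \Po _).
apply/polyP => i; rewrite coef_map /= coset_id ?cycle_id //; exact: rz_act1.
Qed.

Let inv_const (r : {poly B}) : (size r < size Y)%N ->
  (forall g, g \in P -> act g r = r) -> (size r <= 1)%N.
Proof.
rewrite Y_size ltnS => rp rinv; apply: (shift_invariant_const pB rp).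
by rewrite -act_z rinv.
Qed.

Let coset_surj q : q \in (P / Z)%g -> exists2 g, g \in P & coset Z g = q.
Proof. by move=> qQ; exists (repr q); rewrite ?reprP ?coset_reprK. Qed.

Let cosetM g h : g \in P -> h \in P -> coset Z (g * h)%g = (coset Z g * coset Z h)%g.
Proof. by move=> gP hP; rewrite morphM ?nZ. Qed.

Let Y_monic : Y \is monic.
Proof. by apply/monicP; rewrite /Y -addrA lead_coefDl ?lead_coefXn ?size_polyXn. Qed.

Let Y_size1 : (1 < size Y)%N. Proof. by rewrite Y_size ltnS ltnW. Qed.

Let R' : realization k P n.+1 :=
  ext_realization coset_mem_quo coset_surj (morph1 _) cosetM w1 wM (fun g _ => w_size g)
    w_faithful Y_monic Y_size1 Y_inv inv_const.

Let actM g h f : g \in P -> h \in P -> act (g * h)%g f = act h (act g f).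
Proof. exact: (rz_actM (r := R')). Qed.

(** This is the sum of [(X + a)^(p-1)] over [a] in the prime field; it supplies the element of trace
    1 for the next extension. *)
Let trace_Z : \sum_(y in Z) act y ('X^(p.-1)) = -1.
Proof.
set f := \sum_(y in Z) _.
(* [f] is invariant of degree < p, hence equal to its constant coefficient. *)
have f_inv : f \Po ('X + 1) = f.
  rewrite -act_z /f rmorph_sum /= [RHS](reindex_inj (mulIg z)) /=.
  apply: eq_big => [y|y yZ]; first by rewrite groupMr ?cycle_id.
  exact: esym (actM _ (subsetP sZP _ yZ) zP).
have f_size : (size f <= p)%N.
  apply: leq_trans (size_sum _ _ _) _; apply/bigmax_leqP => y _.
  apply: leq_trans (size_poly_subst _ _ (w_size y)) _.
  by rewrite size_polyXn prednK // ltnW.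
rewrite [f]size1_polyC ?(shift_invariant_const pB f_size f_inv) //.
(* At [X = 0] the terms are the powers [chi y ^+ p.-1]: 0 for [y = 1], and 1 for the other p - 1
   elements by Fermat. The total is p - 1 = -1. *)
rewrite -horner_coef0 /f horner_sum (big_setD1 1%g) ?group1 //=.
have actX y : y \in Z -> (act y 'X^(p.-1)).[0] = chi y ^+ p.-1.
  by move=> yZ; rewrite rmorphXn /= poly_substX /w c_chi // !hornerE.
rewrite actX ?group1 // (eq_bigr (fun=> 1)) => [|y]; last first.
  rewrite !inE => /andP [y1 yZ]; rewrite actX //.
  have chi0 : chi y != 0 by apply: contraNneq y1 => /(chi_eq0 yZ) ->.
  apply: (mulfI chi0); rewrite -exprS prednK ?(ltnW p_gt1) // mulr1 /chi.
  by rewrite -(pFrobenius_autE pB) pFrobenius_aut_nat.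
rewrite sumr_const -c_chi ?group1 // c1 expr0n -subn1 subn_eq0 leqNgt p_gt1 add0r.
have -> : #|<[z]>%g :\ 1%g| = p.-1.
  by rewrite -z_order orderE (cardsD1 1%g <[z]>%g) group1.
have : 1 + p.-1%:R = 0 :> B by rewrite -mulrS prednK ?(ltnW p_gt1) // pcharf0.
by move/eqP; rewrite addrC addr_eq0 => /eqP ->; rewrite polyCN.
Qed.

(** The trace is taken in stages: over [Z], which fixes [b0], it turns [- b0 X^(p-1)] into [b0], and
    over [P / Z] it turns [b0] into 1. *)
Lemma central_ext_realization :
  exists (R' : realization k P n.+1) (b : rz_ring R'),
    \sum_(g in P) rz_act R' g b = 1.
Proof.
exists R', (- (b0%:P * 'X^(p.-1))); change (rz_act R') with act.
rewrite (partition_big (coset Z) (mem (P / Z)%g)) => [|g]; last exact: coset_mem_quo.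
rewrite -polyC1 -trace_b0 rmorph_sum; apply: eq_bigr => q qQ /=.
(* The elements over [q] are the [y * repr q] with [y] in [Z]; in a right action [y] acts first. *)
have rP := reprP qQ; rewrite (reindex_inj (mulIg (repr q))) /=.
rewrite (eq_bigl (mem Z)) => [|y]; last first.
  rewrite groupMr // [RHS]/=; have [yP|yP] := boolP (y \in P); last first.
    by symmetry; apply: contraNF yP => /(subsetP sZP).
  rewrite cosetM // coset_reprK -{2}[q]mul1g (inj_eq (mulIg q)).
  by apply/eqP/idP => [/(coset_idr (nZ yP))|/coset_id].
transitivity (act (repr q) (\sum_(y in Z) act y (- (b0%:P * 'X^(p.-1))))).
  rewrite rmorph_sum; apply: eq_bigr => y yZ.
  exact: actM (subsetP sZP _ yZ) rP.
rewrite (eq_bigr (fun y => - b0%:P * act y 'X^(p.-1))) => [|y yZ]; last first.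
  rewrite -mulNr rmorphM rmorphN /= poly_substC coset_id //.
  by rewrite rz_act1.
rewrite -mulr_sumr trace_Z mulrN1 opprK poly_substC coset_reprK.
exact: erefl.
Qed.

End CentralExtension.

(** * p-groups and abelian factors of order prime to p *)

Lemma realization1 (k : fieldType) (gT : finGroupType) (G : {group gT}) :
  G :=: 1%g -> inhabited (realization k G 0).
Proof.
move=> G1; have idI : injective (idfun : {mpoly k[0]} -> {mpoly k[0]}) by [].
split; apply: (@Realization k gT G 0 {mpoly k[0]} idfun idfun (fun=> idfun)) => //.
- by exists id.
- by move=> g; rewrite G1 => /set1P.
- by move=> b; split=> // _; exists b.
Qed.

(** The element of trace 1 is carried through the induction on [#|P|] because the next central
    extension consumes it. *)
Lemma pgroup_realization (k : fieldType) (p : nat) (gT : finGroupType)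
    (P : {group gT}) : p \in [pchar k] -> (p.-group P)%g ->
  exists n (R : realization k P n) (b : rz_ring R),
    (p ^ n)%N = #|P| /\ \sum_(g in P) rz_act R g b = 1.
Proof.
move=> pk; have [m] := ubnP #|P|.
elim: m gT P => // m IH gT P; rewrite ltnS => Pm pP.
have [P1|ntP] := eqVneq (P : {set gT}) 1%g.
  have [R] := realization1 k P1.
  exists 0%N, R, 1; rewrite P1 cards1 expn0; split=> //.
  by rewrite (eq_bigl (mem [set 1%g])) ?big_set1 ?rmorph1 // => g; rewrite P1.
have ntZ : 'Z(P)%g != 1%g.
  by apply: contra ntP => /eqP/(trivg_center_pgroup pP) ->.
have [p_pr pdZ _] := pgroup_pdiv (pgroupS (center_sub P) pP) ntZ.
have [z zZ zp] := Cauchy p_pr pdZ.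
have zP : z \in P by case/setIP: zZ.
have nZP : (P \subset 'N(<[z]>))%g.
  apply: (subset_trans _ (cent_sub _)).
  by rewrite centsC cycle_subG; case/setIP: zZ.
have cardQ : (#|(P / <[z]>)%g| * p)%N = #|P|.
  by rewrite card_quotient // mulnC -zp orderE Lagrange ?cycle_subG.
have p_gt1 := prime_gt1 p_pr.
have Q_lt : (#|(P / <[z]>)%G| < m)%N.
  by apply: leq_trans Pm; rewrite -cardQ ltn_Pmulr // cardG_gt0.
have [n [R [b [nQ trb]]]] := IH _ (P / <[z]>)%G Q_lt (quotient_pgroup _ pP).
have [R' [b' trb']] := central_ext_realization pk zZ zp trb.
by exists n.+1, R', b'; rewrite expnSr nQ.
Qed.

(** As [m] is nonzero in [k], [X^m - 1] is separable and has m distinct roots; m distinct m-th roots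
    of unity in a field include a primitive one. *)
Lemma exists_primitive_root (k : closedFieldType) (m : nat) :
  m%:R != 0 :> k -> exists zeta : k, m.-primitive_root zeta.
Proof.
move=> m0; have m_gt0 : (0 < m)%N by case: m m0 => //; rewrite eqxx.
have [rs rsE] := closed_field_poly_normal ('X^m - 1 : {poly k}).
have lead1 : lead_coef ('X^m - 1 : {poly k}) = 1 by exact: lead_coefXnsubC.
rewrite lead1 scale1r in rsE.
have rs_size : size rs = m.
  apply/eqP; rewrite -eqSS -(size_prod_XsubC _ id) -rsE.
  by rewrite size_XnsubC.
have rs_unity : all m.-unity_root rs.
  apply/allP => x xrs; rewrite unity_rootE -subr_eq0.
  have : root ('X^m - 1%:P) x by rewrite rsE root_prod_XsubC.
  by rewrite /root !hornerE.
have : has m.-primitive_root rs.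
  apply: has_prim_root => //; last by rewrite rs_size.
  rewrite -separable_prod_XsubC -rsE separable_Xn_sub_1 //.
by case/hasP => x _; exists x.
Qed.

Section CyclicExtension.
Variables (k : closedFieldType) (gT : finGroupType) (H G : {group gT}) (x : gT).
Hypothesis defG : (H \x <[x]> = G)%g.
Variables (n : nat) (R : realization k H n).
Local Notation B := (rz_ring R).
Variables (zeta : k).
Hypothesis zeta_prim : #[x]%g.-primitive_root zeta.

Let pi : gT -> gT := divgr H <[x]>.
Let rho : gT -> gT := remgr H <[x]>.

Let defM : (H * <[x]> = G)%g. Proof. by case/dprodP: defG. Qed.
Let cHx : (<[x]> \subset 'C(H))%g. Proof. by case/dprodP: defG. Qed.
Let tiHx : (H :&: <[x]> = 1)%g. Proof. by case/dprodP: defG. Qed.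
Let complx : <[x]>%G \in [complements to H in G]%g.
Proof. by apply/complP. Qed.

Let nHG : (H <| G)%g. Proof. by case/dprod_normal2: defG. Qed.

Let pi_in g : g \in G -> pi g \in H. Proof. by rewrite -defM; apply: mem_divgr. Qed.
Let rho_in g : g \in G -> rho g \in <[x]>%g.
Proof. by rewrite -defM; apply: mem_remgr. Qed.

Let pi_id h : h \in H -> pi h = h. Proof. exact: divgr_id. Qed.

Let piM g h : g \in G -> h \in G -> pi (g * h)%g = (pi g * pi h)%g.
Proof. by move=> gG hG; apply: (divgrM complx) => //. Qed.

Let rhoM g h : g \in G -> h \in G -> rho (g * h)%g = (rho g * rho h)%g.
Proof. by move=> gG hG; apply: (remgrM complx nHG). Qed.

(** The character [x |-> zeta] of [<[x]>], pulled back to [G] along the projection [rho], with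
    values in the constants of [B]. *)
Let u (g : gT) : B := rz_coord R (zeta ^+ cyc_exp x (rho g))%:MP.

Let xG : x \in G.
Proof. by rewrite -defM; apply: (subsetP (mulG_subr _ _)); exact: cycle_id. Qed.

Let pi_x : pi x = 1%g.
Proof. by have := divgrMid tiHx (group1 H) (cycle_id x); rewrite mul1g. Qed.

Let rho_x : rho x = x.
Proof. by have := remgrMid tiHx (group1 H) (cycle_id x); rewrite mul1g. Qed.

Let rhoE g : pi g = 1%g -> rho g = g.
Proof. by move=> pig; rewrite [RHS](divgr_eq H <[x]>%g g) -/(pi g) pig mul1g. Qed.

Let uM g h : g \in G -> h \in G -> u (g * h)%g = u g * u h.
Proof.
move=> gG hG; rewrite /u -!rmorphM -exprD; congr (rz_coord R _%:MP).
apply/eqP; rewrite (eq_prim_root_expr zeta_prim) rhoM //.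
by rewrite cyc_expM ?rho_in.
Qed.

Let u_expX g : g \in G -> u g ^+ #[x]%g = 1.
Proof.
move=> gG; rewrite /u -!rmorphXn -exprM mulnC exprM.
by rewrite (prim_expr_order zeta_prim) expr1n !rmorph1.
Qed.

Let u_eq1 g i : rho g \in <[x]>%g -> u g ^+ i = 1 -> (rho g ^+ i = 1)%g.
Proof.
move=> rg; rewrite /u -!rmorphXn -exprM -(rmorph1 (rz_coord R)).
move/(bij_inj (rz_coord_bij R)) => /(fmorph_inj (@mpolyC n k)) /eqP.
rewrite -(prim_order_dvd zeta_prim) order_dvdn expgM.
by rewrite expg_cyc_exp // => /eqP.
Qed.

Let w (g : gT) : {poly B} := u g *: 'X.
Local Notation act := (ext_act pi w).

Let w1 : w 1%g = 'X.
Proof.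
(* [u 1] is idempotent and a root of unity, hence equal to 1 in the domain [B]. *)
have := uM (group1 G) (group1 G); rewrite mulg1 => /eqP.
rewrite /w -{1}[u _]mulr1 eq_sym (inj_eq (mulfI _)) => [/eqP ->|].
  by rewrite scale1r.
apply/eqP => u0; have := u_expX (group1 G); rewrite u0 expr0n gtn_eqF ?order_gt0 //=.
by move/eqP; rewrite eq_sym oner_eq0.
Qed.

Let wM g h : g \in G -> h \in G -> w (g * h)%g = act h (w g).
Proof.
move=> gG hG; rewrite /w -[u g *: 'X]mul_polyC rmorphM /= poly_substX poly_substC.
by rewrite rz_actC ?pi_in // mul_polyC scalerA uM.
Qed.

Let w_size g : g \in G -> (size (w g) <= 2)%N.
Proof. by move=> _; apply: leq_trans (size_scale_leq _ _) _; rewrite size_polyX. Qed.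

Let w_faithful g : g \in G -> pi g = 1%g -> w g = 'X -> g = 1%g.
Proof.
move=> gG pig /(congr1 (fun q : {poly B} => q`_1)).
rewrite coefZ coefX eqxx mulr1 -[u g]expr1 => /(u_eq1 (rho_in gG)).
by rewrite expg1 rhoE.
Qed.

Let Y : {poly B} := 'X^#[x]%g.

Let Y_inv g : g \in G -> act g Y = Y.
Proof.
by move=> gG; rewrite /Y rmorphXn /= poly_substX /w exprZn u_expX // scale1r.
Qed.

Let act_x r i : (act x r)`_i = u x ^+ i * r`_i.
Proof.
have rE : act x r = \sum_(j < size r) (u x ^+ j * r`_j) *: 'X^j.
  rewrite -{1}[r]coefK poly_def rmorph_sum; apply: eq_bigr => j _ /=.
  rewrite -mul_polyC rmorphM rmorphXn /= poly_substX poly_substC /w.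
  by rewrite pi_x rz_act1 exprZn mul_polyC scalerA mulrC.
rewrite rE -(poly_def (size r) (fun j => u x ^+ j * r`_j)) coef_poly.
by case: ltnP => // /(nth_default 0) ->; rewrite mulr0.
Qed.

(** [x] multiplies the coefficient of [X^i] by [u x ^+ i], which is not 1 for [0 < i < #[x]] since
    [zeta] is primitive; those coefficients vanish. *)
Let inv_const (r : {poly B}) : (size r < size Y)%N ->
  (forall g, g \in G -> act g r = r) -> (size r <= 1)%N.
Proof.
rewrite size_polyXn ltnS => rx rinv; apply/leq_sizeP => -[//|i] _.
have [ix|xi] := ltnP i.+1 #[x]%g; last by apply: nth_default (leq_trans rx xi).
have := act_x r i.+1; rewrite (rinv _ xG) => /eqP.
rewrite -{1}[r`__]mul1r -subr_eq0 -mulrBl mulf_eq0 subr_eq0 => /orP [/eqP|/eqP //].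
move/esym/u_eq1; rewrite rho_x cycle_id => /(_ isT) /eqP.
by rewrite -order_dvdn => /(dvdn_leq (ltn0Sn i)); rewrite leqNgt ix.
Qed.

Definition cyclic_ext_realization : realization k G n.+1.
Proof.
apply: (@ext_realization _ _ _ _ _ _ R pi w Y) => //.
- by move=> h hH; exists h; rewrite ?pi_id // (subsetP (normal_sub nHG)).
- exact: pi_id (group1 H).
- exact: monicXn.
- by rewrite size_polyXn ltnS order_gt0.
Defined.

End CyclicExtension.

(** Serves both cases of the theorem. The variables number [log_p #|P|] plus the number of cyclic
    factors of [A], and each of them accounts for a factor of [#|G|] that is at least [r]. *)
Lemma dprod_abelian_realization (k : closedFieldType) (p : nat)
    (gT : finGroupType) (P A G : {group gT}) :
  p \in [pchar k] -> (p.-group P)%g -> (p^'.-group A)%g -> abelian A ->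
  (P \x A = G)%g ->
  exists n (R : realization k G n),
    forall r, (forall q, prime q -> q %| #|G| -> r <= q)%N -> (r ^ n <= #|G|)%N.
Proof.
move=> pk pP pA cAA defG; have p_pr := pcharf_prime pk.
have [b defA bA] := abelian_structure cAA.
(* Each cyclic factor costs a variable and must contribute at least [r] to the order, so trivial
   factors have to be excluded. *)
have b_gt1 : all (fun x => 1 < #[x]%g)%N b.
  by have := abelian_type_gt1 A; rewrite -bA all_map.
elim: b A G pA defA defG b_gt1 {cAA bA} => [|x b IH] A G pA.
  rewrite big_nil => A1; rewrite -A1 dprodg1 => /group_inj PG _.
  rewrite {}PG {P} in pP *.
  have [n [R [_ [nG _]]]] := pgroup_realization pk pP.
  exists n, R => r rmin; rewrite -nG; case: n {R} nG => // n nG.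
  by rewrite leq_exp2r // rmin // -nG expnS dvdn_mulr.
rewrite big_cons => defA defG /= /andP [x_gt1 b_gt1].
have [[_ A' _ defA' _ _ _]] := dprodP defA; rewrite defA' in defA.
have defG' : ((P \x A') \x <[x]> = G)%g.
  by rewrite -dprodA [(A' \x _)%g]dprodC defA.
have [[G' _ defG'' _ _ _ _]] := dprodP defG'; rewrite defG'' in defG'.
have xA : x \in A.
  by have [_ <- _ _] := dprodP defA; apply: (subsetP (mulG_subl _ _)); exact: cycle_id.
have sA'A : A' \subset A.
  by have [_ <- _ _] := dprodP defA; rewrite mulG_subr.
have [n [R Rn]] := IH A' G' (pgroupS sA'A pA) defA' defG'' b_gt1.
have x_order : #[x]%g%:R != 0 :> k.
  rewrite -(dvdn_pcharf pk) -prime_coprime // coprime_sym.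
  apply: (@pnat_coprime p^'); first exact: mem_p_elt pA xA.
  by rewrite pnatNK pnat_id.
have [zeta zeta_prim] := exists_primitive_root x_order.
exists n.+1, (cyclic_ext_realization defG' R zeta_prim) => r rmin.
have cardG := dprod_card defG'.
rewrite expnSr -cardG leq_mul // ?Rn //.
  by move=> q q_pr qG'; rewrite rmin // -cardG dvdn_mulr.
apply: leq_trans (rmin (pdiv #[x]%g) _ _) (pdiv_leq (order_gt0 x)).
  exact: pdiv_prime.
by rewrite (dvdn_trans (pdiv_dvd _)) // -cardG orderE dvdn_mull.
Qed.

(** * Transport to the polynomial ring *)

Section MpolyAction.
Variables (k : fieldType) (gT : finGroupType) (G : {group gT}) (n : nat).
Variable R : realization k G n.
Variable uncoord : rz_ring R -> {mpoly k[n]}.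
Hypotheses (coordK : cancel (rz_coord R) uncoord).
Hypotheses (uncoordK : cancel uncoord (rz_coord R)).

(** The identity off [G], because [is_action] asks for injectivity at every element of [gT]. *)
Definition mpoly_act (f : {mpoly k[n]}) (g : gT) : {mpoly k[n]} :=
  if g \in G then uncoord (rz_act R g (rz_coord R f)) else f.

Let coord_act f g : g \in G ->
  rz_coord R (mpoly_act f g) = rz_act R g (rz_coord R f).
Proof. by move=> gG; rewrite /mpoly_act gG uncoordK. Qed.

Let coord_inj : injective (rz_coord R) := can_inj coordK.

Lemma mpoly_act_is_action : is_action G mpoly_act.
Proof.
split=> [g f f' | f g h gG hG]; last first.
  by apply: coord_inj; rewrite !coord_act ?groupM // rz_actM.
rewrite /mpoly_act; case: ifP => // gG /(can_inj uncoordK) ff'.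
apply: coord_inj; rewrite -[LHS](rz_act1 (r := R)) -[RHS](rz_act1 (r := R)).
by rewrite -(mulgV g) !rz_actM ?groupV // ff'.
Qed.

Let mpoly_act_linear g : g \in G -> linear (mpoly_act^~ g).
Proof.
move=> gG a f f'; apply: coord_inj; rewrite coord_act // -!mul_mpolyC.
by rewrite !rmorphD !rmorphM /= !coord_act // rz_actC.
Qed.

Let mpoly_act_monoid g : g \in G -> monoid_morphism (mpoly_act^~ g).
Proof.
move=> gG; split=> [|f f']; apply: coord_inj.
  by rewrite coord_act // !rmorph1.
by rewrite rmorphM !coord_act // !rmorphM.
Qed.

Definition mpoly_action : algebra_action G {mpoly k[n]} :=
  @AlgebraAction _ _ _ _ (Action mpoly_act_is_action) mpoly_act_linear mpoly_act_monoid.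

Lemma mpoly_action_faithful : faithful_action mpoly_action.
Proof.
move=> g gG gid; apply: (rz_faithful (r := R) gG) => b.
by rewrite -[b]uncoordK -coord_act // [mpoly_act _ _]gid.
Qed.

Lemma mpoly_action_invP f :
  f \in invariant_pred mpoly_action <-> exists F, rz_coord R f = rz_inv R F.
Proof.
rewrite -rz_invP; split=> [/invariantP finv g gG|finv].
  by rewrite -coord_act // [mpoly_act _ _]finv.
by apply/invariantP => g gG; apply: coord_inj; rewrite [LHS]coord_act ?finv.
Qed.

Let inv_ex (f : invariants mpoly_action) : exists F, rz_coord R (val f) == rz_inv R F.
Proof.
by have [F FE] := (mpoly_action_invP (val f)).1 (valP f); exists F; apply/eqP.
Qed.

(** [inv_ex] uses a boolean equality so that [xchoose] applies; injectivity of [rz_inv] makes the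
    chosen [F] unique, hence [inv_coord] linear and multiplicative. *)
Definition inv_coord (f : invariants mpoly_action) : {mpoly k[n]} := xchoose (inv_ex f).

Let inv_coordE f : rz_inv R (inv_coord f) = rz_coord R (val f).
Proof. by rewrite (eqP (xchooseP (inv_ex f))). Qed.

Let inv_inj := rz_inv_inj (r := R).

Let inv_coord_linear : linear inv_coord.
Proof.
move=> a f f'; apply: inv_inj; rewrite inv_coordE -mul_mpolyC.
rewrite linearP -mul_mpolyC !rmorphD !rmorphM /= !inv_coordE.
by rewrite rz_invC.
Qed.

Let inv_coord_monoid : monoid_morphism inv_coord.
Proof.
split=> [|f f']; apply: inv_inj; rewrite inv_coordE.
  by rewrite !rmorph1.
by rewrite !rmorphM /= !inv_coordE.
Qed.

HB.instance Definition _ :=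
  GRing.isLinear.Build k (invariants mpoly_action) {mpoly k[n]} _ inv_coord
    inv_coord_linear.
HB.instance Definition _ :=
  GRing.isMonoidMorphism.Build (invariants mpoly_action) {mpoly k[n]} inv_coord
    inv_coord_monoid.

Lemma mpoly_action_isomorphic : algebra_isomorphic (invariants mpoly_action) {mpoly k[n]}.
Proof.
exists inv_coord.
have invF F : uncoord (rz_inv R F) \in invariant_pred mpoly_action.
  by apply/mpoly_action_invP; exists F; rewrite uncoordK.
exists (fun F => exist _ (uncoord (rz_inv R F)) (invF F)) => [f|F].
  by apply: val_inj; rewrite /= inv_coordE coordK.
by apply: inv_inj; rewrite inv_coordE /= uncoordK.
Qed.

End MpolyAction.

(** * Krull dimension *)

Section DegreeBounds.
Variables (k : fieldType) (n : nat).
Implicit Types p q : {mpoly k[n]}.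

Lemma msizeM_leq d e p q :
  (msize p <= d.+1)%N -> (msize q <= e.+1)%N -> (msize (p * q) <= (d + e).+1)%N.
Proof.
have [->|p0] := eqVneq p 0; first by rewrite mul0r msize0.
have [->|q0] := eqVneq q 0; first by rewrite mulr0 msize0.
move=> pd qe; rewrite msizeM // -subn1 leq_subLR add1n -addSn -addnS.
exact: leq_add.
Qed.

Lemma msizeXn_leq d p e : (msize p <= d.+1)%N -> (msize (p ^+ e) <= (e * d).+1)%N.
Proof.
move=> pd; elim: e => [|e IH]; first by rewrite expr0 msize1.
by rewrite exprS mulSn; apply: msizeM_leq.
Qed.

Lemma msize_prod_leq (I : Type) (s : seq I) (F : I -> {mpoly k[n]}) d :
  (forall i, msize (F i) <= d.+1)%N -> (msize (\prod_(i <- s) F i) <= (size s * d).+1)%N.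
Proof.
move=> Fd; elim: s => [|i s IH]; first by rewrite big_nil msize1.
by rewrite big_cons mulSn; apply: msizeM_leq.
Qed.

End DegreeBounds.

(** A count of monomials: the products of the [v i ^+ t i] with all exponents below [N] number
    [N^(n+1)], but their degrees are linear in [N], so they lie in a space whose dimension is of
    order [N^n]. *)
Lemma mpoly_algebraic_dependence (k : fieldType) (n : nat)
    (v : 'I_n.+1 -> {mpoly k[n]}) :
  exists2 F : {mpoly k[n.+1]}, F != 0 & mmap (@mpolyC n k) v F = 0.
Proof.
pose D := \max_i msize (v i).
have vD i : (msize (v i) <= D.+1)%N by rewrite leqW // (leq_bigmax i).
(* With [C = (n + 1) D + 1], the choice of [M] gives [M <= N C], and [N > C^n] then gives
   [M^n <= N^n C^n < N^(n+1)]. *)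
pose N := ((n.+1 * D).+1 ^ n).+1; pose M := (n.+1 * (N * D)).+1.
pose T1 := {ffun 'I_n.+1 -> 'I_N}; pose T2 := {ffun 'I_n -> 'I_M}.
pose mon1 (t : T1) : 'X_{1..n.+1} := [multinom (t i : nat) | i < n.+1].
pose mon2 (s : T2) : 'X_{1..n} := [multinom (s i : nat) | i < n].
pose pw (t : T1) := \prod_i v i ^+ t i.
have pw_size t : (msize (pw t) <= M)%N.
  rewrite /M -[n.+1 in X in (_ <= X)%N]card_ord cardT.
  rewrite /pw -[index_enum _]/(Finite.enum _) -enumT; apply: msize_prod_leq => i.
  apply: leq_trans (msizeXn_leq _ (vD i)) _; rewrite ltnS leq_mul2r.
  by rewrite (ltnW (ltn_ord _)) orbT.
pose A := \matrix_(i < #|T1|, j < #|T2|) (pw (enum_val i))@_(mon2 (enum_val j)).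
have cards : (#|T2| < #|T1|)%N.
  rewrite !card_ffun !card_ord.
  have MN : (M <= N * (n.+1 * D).+1)%N.
    by rewrite mulnS mulnCA /M -add1n leq_add2r.
  have leq_exp (a b e : nat) : (a <= b -> a ^ e <= b ^ e)%N.
    by move=> ab; elim: e => // e IH; rewrite !expnS leq_mul.
  apply: leq_ltn_trans (leq_exp _ _ n MN) _.
  by rewrite expnMn expnS mulnC ltn_pmul2r ?expn_gt0.
have [u u0 uA] : exists2 u : 'rV_#|T1|, u != 0 & u *m A = 0.
  exists (nz_row (kermx A)); last by apply/sub_kermxP; exact: nz_row_sub.
  rewrite nz_row_eq0 kermx_eq0 /row_free ltn_eqF //.
  exact: leq_ltn_trans (rank_leq_col A) cards.
pose F := \sum_(t : T1) u 0 (enum_rank t) *: 'X_[k, mon1 t].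
have mon1_inj : injective mon1.
  move=> t t' /mnmP tt'; apply/ffunP => i; apply: val_inj.
  by have := tt' i; rewrite !mnmE.
exists F.
  have [j uj] : exists j, u 0 j != 0 by exact/rV0Pn.
  apply: contra uj => /eqP F0.
  have := mcoeff0 k (mon1 (enum_val j)); rewrite -F0 /F.
  rewrite raddf_sum (bigD1 (enum_val j)) //= big1 => [|t tj].
    by rewrite mcoeffZ mcoeffX eqxx mulr1 addr0 enum_valK => ->.
  by rewrite mcoeffZ mcoeffX (inj_eq mon1_inj) (negPf tj) mulr0.
have mmapF : mmap (@mpolyC n k) v F = \sum_t u 0 (enum_rank t) *: pw t.
  rewrite /F raddf_sum; apply: eq_bigr => t _ /=.
  rewrite mmapZ mul_mpolyC mmapX /mmap1 /pw; congr (_ *: _).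
  by apply: eq_bigr => i _; rewrite mnmE.
rewrite mmapF; apply/mpolyP => m; rewrite mcoeff0 raddf_sum /=.
(* [pw t] has degree less than [M], so exponents at least [M] do not occur; at the remaining
   monomials the coefficient is an entry of [u *m A]. *)
have [/existsP [i Mi]|/existsPn small] := boolP [exists i, M <= m i]%N.
  apply: big1 => t _; rewrite mcoeffZ memN_msupp_eq0 ?mulr0 //.
  apply: msize_mdeg_ge; apply: leq_trans (pw_size t) _; apply: (leq_trans Mi).
  by rewrite mdegE (bigD1 i) //= leq_addr.
have m_lt i : (m i < M)%N by rewrite ltnNge small.
pose s : T2 := [ffun i => Ordinal (m_lt i)].
have -> : m = mon2 s by apply/mnmP => i; rewrite mnmE ffunE.
have /rowP/(_ (enum_rank s)) := uA; rewrite !mxE => uAs.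
rewrite -[RHS]uAs (reindex (@enum_val _ (mem T1))) /=; last first.
  by exists enum_rank => t _; rewrite ?enum_valK ?enum_rankK.
apply: eq_bigr => j _; rewrite mcoeffZ enum_valK !mxE enum_rankK.
exact: erefl.
Qed.

Lemma muni_inv_mmap (k : fieldType) (R : comNzRingType) (iota : {rmorphism k -> R})
    (n : nat) (v : 'I_n.+1 -> R) (q : {poly {mpoly k[n]}}) (c : {mpoly k[n]}) :
  mmap iota v (muni_inv n k (q * 'X + c%:P)) =
  mmap iota v (muni_inv n k q) * v ord_max + mmap iota (v \o widen) c.
Proof.
rewrite !rmorphD !rmorphM /= horner_morphX mmapX mmap1U; congr (_ + _).
rewrite horner_morphC; move: c.
apply: (@mpoly_rmorphism_ext n k R (mmap iota v \o @mwiden n k)%FUN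
  (mmap iota (v \o widen))).
  by move=> c; rewrite /= mwidenC !mmapC.
by move=> i; rewrite /= mwidenX1 !mmapX !mmap1U.
Qed.

(* The i-th variable takes its value in the (n - i)-th step of the chain, since
   [muni] singles out the last variable. *)
Lemma chain_eval_notin (k : fieldType) (R : comNzRingType)
    (iota : {rmorphism k -> R}) (n : nat) (J : nat -> prime_idealr R)
    (v : 'I_n -> R) (F : {mpoly k[n]}) :
  (forall i, (i < n)%N -> {subset J i <= J i.+1}) ->
  (forall i : 'I_n, v i \in J (n - i)%N /\ v i \notin J (n - i).-1) ->
  F != 0 -> mmap iota v F \notin J 0%N.
Proof.
elim: n J v F => [|n IH] J v F Jsub vJ F0.
  have FC : F = (F@_(0%MM))%:MP.
    apply: msize1_polyC; rewrite msizeE; apply/bigmax_leqP_seq => m _ _.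
    by rewrite mdegE big_ord0.
  have c0 : F@_(0%MM) != 0 by apply: contra F0 => /eqP h; rewrite FC h.
  rewrite FC mmapC; apply: contraFN (idealr1 (J 0%N)) => inJ.
  by rewrite -(rmorph1 iota) -(mulVf c0) rmorphM idealMr.
rewrite -(muniK F); have : muni F != 0.
  by apply: contra F0 => /eqP F0; rewrite -(muniK F) F0 rmorph0.
have [vJ1 vJ0] := vJ ord_max; rewrite subSnn /= in vJ1 vJ0.
move: (muni F); elim/poly_ind => [|q c IHq]; first by rewrite eqxx.
move=> qc0; rewrite muni_inv_mmap.
(* If [c = 0], the value is a product of two elements outside the prime [J 0]. *)
have [c0|c0] := eqVneq c 0.
  have q0 : q != 0 by apply: contra qc0 => /eqP ->; rewrite c0 mul0r addr0.
  rewrite c0 rmorph0 addr0 prime_idealrM negb_or vJ0 andbT; exact: IHq.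
(* Otherwise the value is congruent modulo [J 1] to that of [c], as [v ord_max] lies in [J 1]. By
   induction along the shifted chain it is outside [J 1], hence outside [J 0]. *)
have : mmap iota (v \o widen) c \notin J 1%N.
  apply: (IH (J \o S)) => // [i ilt|i]; first exact: Jsub.
  have [] := vJ (widen i); rewrite /= subSn ?(ltnW (ltn_ord i)) //= => h1 h2; split=> //.
  by rewrite prednK // subn_gt0.
apply: contra => /(Jsub 0%N isT) inJ1.
rewrite -(addKr (mmap iota v (muni_inv n k q) * v ord_max) (mmap iota (v \o widen) c)).
by rewrite rpredD // rpredN idealMr.
Qed.

Section KernelIdeal.
Variables (R : comNzRingType) (S : idomainType) (f : {rmorphism R -> S}).

Definition kernel_pred : R -> bool := fun x => f x == 0.

Let kernel_idealr : idealr_closed kernel_pred.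
Proof.
split=> [||a u v]; rewrite !unfold_in ?rmorph0 ?rmorph1 ?oner_eq0 //.
by move=> /eqP fu /eqP fv; rewrite rmorphD rmorphM fu fv mulr0 addr0.
Qed.

Let kernel_prime : prime_idealr_closed kernel_pred.
Proof. by move=> u v; rewrite !unfold_in rmorphM mulf_eq0. Qed.

HB.instance Definition _ := isIdealr.Build R kernel_pred kernel_idealr.
HB.instance Definition _ := isPrimeIdealrClosed.Build R kernel_pred kernel_prime.

Definition kernel_ideal : prime_idealr R := kernel_pred.

End KernelIdeal.

Lemma krull_dim_mpoly (k : fieldType) (n : nat) : krull_dim {mpoly k[n]} n.
Proof.
split.
  (* The kernel of [ev i] is generated by the variables of index less than [i]. For [i < j], [ev j]
     factors through [ev i], and the variable of index [i] separates the two kernels. *)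
  pose ev (i : nat) : {rmorphism {mpoly k[n]} -> {mpoly k[n]}} :=
    mmap (@mpolyC n k) (fun j : 'I_n => if (j < i)%N then 0 else 'X_j).
  exists (fun i => kernel_ideal (ev i)) => i j ij; split=> [f|].
    rewrite !unfold_in; suff evE : ev j f = ev j (ev i f).
      by move=> /eqP evi; rewrite /kernel_pred evE [ev i f]evi rmorph0.
    move: f.
    apply: (@mpoly_rmorphism_ext _ _ _ (ev j) (ev j \o ev i)%FUN) => [c|l] /=.
      by rewrite /ev /= !mmapC.
    rewrite /ev /= !mmapX !mmap1U; case: (ltnP l i) => li.
      by rewrite rmorph0 (ltn_trans li ij).
    by rewrite mmapX mmap1U.
  have i_lt : (i < n)%N by rewrite -ltnS; apply: leq_trans (ltn_ord j).
  exists 'X_(Ordinal i_lt); rewrite !unfold_in /= mmapX mmap1U /=.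
    by rewrite ij.
  by rewrite ltnn -msize_poly_eq0 msizeX.
move=> m I Ichain; rewrite leqNgt; apply/negP => nm.
(* [inord] extends the chain to all of [nat]; only the indices up to [n.+1 <= m] are used. *)
pose J i := I (inord i).
have Jstep i : (i <= n)%N ->
    {subset J i <= J i.+1} /\ exists2 x, x \in J i.+1 & x \notin J i.
  move=> i_n; have i_m := leq_ltn_trans i_n nm.
  by apply: Ichain; rewrite !inordK // ltnW.
have vP (i : 'I_n.+1) : exists x, x \in J (n.+1 - i)%N /\ x \notin J (n.+1 - i).-1.
  have [|_ [x xJ xJ']] := Jstep (n - i)%N; first exact: leq_subr.
  by exists x; rewrite subSn -1?ltnS.
have [v vJ] := fin_all_exists vP.
have [F F0 vF] := mpoly_algebraic_dependence v.
have Jsub i (i_n : (i < n.+1)%N) := (Jstep i i_n).1.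
have /negP := @chain_eval_notin k _ (@mpolyC n k) n.+1 J v F Jsub vJ F0.
by rewrite vF idealr0.
Qed.

(* Decomposition of the group and the bound on the dimension *)
Local Close Scope ring_scope.

Theorem theorem0p7 (k : closedFieldType) (p : nat) (hp : p \in [pchar k]%R)
  (gT : finGroupType) (G : {group gT})
  (hG : abelian G \/ p_elementary p G)
  (r : nat) (hr : prime r) (hrG : r %| #|G|)
  (hrmin : forall q : nat, prime q -> q %| #|G| -> r <= q) :
  exists n d : nat,
    krull_dim {mpoly k[n]} d /\ d <= trunc_log r #|G| /\
    exists to : algebra_action G {mpoly k[n]},
      faithful_action to /\ algebra_isomorphic (invariants to) {mpoly k[n]}.
Proof.
have [n [R Rn]] : exists n (R : realization k G n),
    forall r, (forall q, prime q -> q %| #|G| -> r <= q) -> r ^ n <= #|G|.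
  have p_pr := pcharf_prime hp.
  case: hG => [cGG | [C [P [defG cycC coC pP]]]].
    (* An abelian group is the direct product of its p-part and its p'-part. *)
    apply: (dprod_abelian_realization hp (pcore_pgroup p G) (pcore_pgroup p^' G)).
      exact: abelianS (pcore_sub _ _) cGG.
    exact: nilpotent_pcoreC (abelian_nil cGG).
  apply: (dprod_abelian_realization hp pP _ (cyclic_abelian cycC)).
    by rewrite /pgroup p'natE // -prime_coprime // coprime_sym.
  by rewrite dprodC.
exists n, n; split; first exact: krull_dim_mpoly.
(* [trunc_log r] is the integer part of the logarithm, so the bound amounts to [r ^ n <= #|G|]. *)
split; first by rewrite trunc_log_max ?prime_gt1 ?Rn.
have [c coordK cK] := rz_coord_bij R.
exists (@mpoly_action _ _ _ _ _ _ coordK cK); split; first exact: mpoly_action_faithful.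
exact: mpoly_action_isomorphic.
Qed.
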